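(* Let $L:I\times\mathbb{R}^4\to\mathbb{R}$ satisfy: (H1) for every $t\in I$ the map $(u_0,u_1,u_2,u_3)\mapsto L(t,u_0,u_1,u_2,u_3)$ is in $C^1(\mathbb{R}^4,\mathbb{R})$; (H2) for every $y\in\mathcal{Y}^1$ the function $t\mapsto L\{y\}(t)$ is continuous at $\omega_0$; (H3) for every $y\in\mathcal{Y}^1$ and every $i\in\{2,3,4,5\}$ the function $t\mapsto\partial_iL\{y\}(t)$ belongs to $\mathcal{Y}^1$. Assume also that for all $y,h\in\mathcal{Y}^1$ the function $g(t,\varepsilon)=L\{y+\varepsilon h\}(t)$ ($|\varepsilon|<\bar\varepsilon$ for some $\bar\varepsilon>0$) satisfies: (i) $g(t,\cdot)$ is differentiable at $0$ uniformly in $t\in[a,b]_{q,\omega}$; (ii) $\int_{\omega_0}^ag(t,\varepsilon)\,d_{q,\omega}t$ and $\int_{\omega_0}^bg(t,\varepsilon)\,d_{q,\omega}t$ exist for all $\varepsilon$ sufficiently close to $0$; (iii) $\int_{\omega_0}^a\partial_2g(t,0)\,d_{q,\omega}t$ and $\int_{\omega_0}^b\partial_2g(t,0)\,d_{q,\omega}t$ exist, where $\partial_2g=\partial g/\partial\varepsilon$. Consider the problem of extremizing $$\mathcal{L}[y]=\int_a^bL\big(t,y(qt+\omega),D_{q,\omega}[y](t),y(a),y(b)\big)\,d_{q,\omega}t$$ over $y\in\mathcal{Y}^1$, where each of the end-point values $y(a)$, $y(b)$ is either prescribed ($y(a)=\alpha$, resp. $y(b)=\beta$) or free. If $\tilde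 y$ is a local minimizer or a local maximizer of this problem, then $$\partial_2L\{\tilde y\}(t)-D_{q,\omega}\big[\partial_3L\{\tilde y\}\big](t)=0\qquad\text{for all }t\in[a,b]_{q,\omega},$$ and: 1. if $y(a)$ is free, then $\displaystyle\partial_3L\{\tilde y\}(a)=\int_a^b\partial_4L\{\tilde y\}(t)\,d_{q,\omega}t$; 2. if $y(b)$ is free, then $\displaystyle\partial_3L\{\tilde y\}(b)=-\int_a^b\partial_5L\{\tilde y\}(t)\,d_{q,\omega}t$.
   Context: Let $q\in\,]0,1[$, $\omega\ge 0$, $\omega_0:=\omega/(1-q)$, let $I\subseteq\mathbb{R}$ be an interval containing $\omega_0$, and let $a,b\in I$ with $a<b$. Hahn difference operator: for $f:I\to\mathbb{R}$ differentiable at $\omega_0$, $D_{q,\omega}[f](t):=\frac{f(qt+\omega)-f(t)}{(q-1)t+\omega}$ if $t\ne\omega_0$, and $D_{q,\omega}[f](\omega_0):=f'(\omega_0)$ (ordinary derivative). $D^0_{q,\omega}[f]=f$ and $D^i_{q,\omega}$ is the $i$-fold iterate. $q,\omega$-integral: with $[k]_q:=\frac{1-q^k}{1-q}$, for $x\in I$, $\int_{\omega_0}^x f(t)\,d_{q,\omega}t:=(x(1-q)-\omega)\sum_{k=0}^{\infty}q^kf(xq^k+\omega[k]_q)$ (said to exist if the series converges), and $\int_a^b f\,d_{q,\omega}t:=\int_{\omega_0}^b f\,d_{q,\omega}t-\int_{\omega_0}^a f\,d_{q,\omega}t$. $[a,b]_{q,\omega}:=\{q^na+\omega[n]_q:n\in\mathbb{N}_0\}\cup\{q^nb+\omega[n]_q:n\in\mathbb{N}_0\}\cup\{\omega_0\}$.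 For $r\in\{0,1\}$, $\mathcal{Y}^r$ is the set of $y:I\to\mathbb{R}$ such that $D^i_{q,\omega}[y]$, $i=0,\dots,r$, are bounded on $[a,b]$ and continuous at $\omega_0$, with $\|y\|_{r,\infty}:=\sum_{i=0}^r\|D^i_{q,\omega}[y]\|_\infty$, $\|y\|_\infty:=\sup_{t\in[a,b]}|y(t)|$. $\partial_iL$ is the partial derivative of $L$ with respect to its $i$th argument ($t$ being the first). For $y\in\mathcal{Y}^1$, $\{y\}(t):=(t,y(qt+\omega),D_{q,\omega}[y](t),y(a),y(b))$, $L\{y\}(t):=L(\{y\}(t))$, $\partial_iL\{y\}(t):=(\partial_iL)(\{y\}(t))$; $D_{q,\omega}[\partial_3L\{y\}]$ is the Hahn derivative of the function $t\mapsto\partial_3L\{y\}(t)$. Uniform differentiability: $g(t,\cdot)$ is differentiable at $0$ uniformly in $t\in[a,b]_{q,\omega}$ if for every $\eta>0$ there is $\delta>0$ such that $0<|\varepsilon|<\delta$ implies $\left|\frac{g(t,\varepsilon)-g(t,0)}{\varepsilon}-\partial_2g(t,0)\right|<\eta$ for all $t\in[a,b]_{q,\omega}$. A function is admissible if it lies in $\mathcal{Y}^1$ and satisfies whichever end-point conditions are prescribed. $\tilde y$ is a local minimizer (resp. maximizer) if it is admissible and there is $\delta>0$ with $\mathcal{L}[\tilde y]\le\mathcal{L}[y]$ (resp. $\ge$) for all admissible $y$ with $\|\tilde y-y\|_{1,\infty}<\delta$.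
   Formalization: The formal theorem additionally assumes that the orbits {q^n a + ω[n]_q} and {q^n b + ω[n]_q} are disjoint; without this the Euler–Lagrange equation can fail on [a,b]_{q,ω} (e.g. q=1/2, ω=0, a=1/2, b=1, L=c(t)u_0, c=1 only at t=1/4). *)

(* Defs.v *)
From HB Require Import structures.
From mathcomp Require Import all_boot all_order all_algebra.
From mathcomp Require Import all_classical all_reals all_analysis.

Set Implicit Arguments.
Unset Strict Implicit.
Unset Printing Implicit Defensive.

Import Order.TTheory GRing.Theory Num.Theory.
Import numFieldNormedType.Exports.

Local Open Scope classical_set_scope.
Local Open Scope ring_scope.

(* A function I -> R on the interval I is a total function R -> R of which     *)
(* only the values on I matter: limits at the point omega_0 (which may be an   *)
(* end point of I) are taken within I.                                         *)

Definition omega0 (R : realType) (q w : R) : R := w / (1 - q).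

Definition qnum (R : realType) (q : R) (k : nat) : R := (1 - q ^+ k) / (1 - q).

Definition diff_quotient (R : realType) (f : R -> R) (x t : R) : R :=
  (f t - f x) / (t - x).

Definition derivable_within (R : realType) (I : set R) (f : R -> R) (x : R) :=
  cvg (diff_quotient f x @ within I x^').

Definition derive_within (R : realType) (I : set R) (f : R -> R) (x : R) : R :=
  lim (diff_quotient f x @ within I x^').

Definition continuous_within_at (R : realType) (I : set R) (f : R -> R)
    (x : R) :=
  f @ within I (nbhs x) --> f x.

Definition hahn (R : realType) (q w : R) (I : set R) (f : R -> R) (t : R) : R :=
  if t == omega0 q w then derive_within I f (omega0 q w)
  else (f (q * t + w) - f t) / ((q - 1) * t + w).

Definition hahn_iter (R : realType) (q w : R) (I : set R) (i : nat)
    (f : R -> R) : R -> R :=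
  iter i (hahn q w I) f.

Definition hahn_series (R : realType) (q w : R) (f : R -> R) (x : R) : R^nat :=
  [series q ^+ k * f (x * q ^+ k + w * qnum q k)]_k.

Definition hahn_int0_exists (R : realType) (q w : R) (f : R -> R) (x : R) :=
  cvgn (hahn_series q w f x).

Definition hahn_int0 (R : realType) (q w : R) (f : R -> R) (x : R) : R :=
  (x * (1 - q) - w) * limn (hahn_series q w f x).

Definition hahn_int (R : realType) (q w a b : R) (f : R -> R) : R :=
  hahn_int0 q w f b - hahn_int0 q w f a.

(* The orbits of a and b can meet only if a and b lie strictly on the same side *)
(* of omega_0.  When they do, the integral from a to b is a finite sum over the *)
(* points of one orbit that precede the other end point, so it ignores the      *)
(* remaining points of hahn_interval q w a b, and no Euler-Lagrange equation    *)
(* can hold there: with q = 1/2, w = 0, a = 1/2, b = 1 and L(t, u) = c(t) u_0,  *)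
(* c being 1 at t = 1/4 and 0 elsewhere, the functional is identically 0, but   *)
(* the derivative of L in u_0 at t = 1/4 is 1.                                  *)
Definition hahn_orbit (R : realType) (q w x : R) : set R :=
  [set q ^+ n * x + w * qnum q n | n in [set: nat]].

Definition hahn_interval (R : realType) (q w a b : R) : set R :=
  hahn_orbit q w a `|` hahn_orbit q w b `|` [set omega0 q w].

(* The first clause makes every D^i y with i <= r meaningful.                  *)
Definition in_Y (R : realType) (q w : R) (I : set R) (a b : R) (r : nat)
    (y : R -> R) : Prop :=
  (forall i, (i < r)%N ->
     derivable_within I (hahn_iter q w I i y) (omega0 q w)) /\
  (forall i, (i <= r)%N ->
     [bounded hahn_iter q w I i y t | t in `[a, b]] /\
     continuous_within_at I (hahn_iter q w I i y) (omega0 q w)).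

Definition sup_norm (R : realType) (a b : R) (f : R -> R) : R :=
  sup [set `|f t| | t in `[a, b]].

Definition Y_norm (R : realType) (q w : R) (I : set R) (a b : R) (r : nat)
    (y : R -> R) : R :=
  \sum_(i < r.+1) sup_norm a b (hahn_iter q w I i y).

Definition C1 (R : realType) (F : 'rV[R]_4 -> R) : Prop :=
  (forall u, differentiable F u) /\
  (forall j : 'I_4, continuous (fun u => 'D_(delta_mx 0 j) F u)).

(* Partial derivative of L with respect to its i-th argument, 2 <= i <= 5: the *)
(* first argument is t, so the i-th one is the coordinate i - 2 of the vector. *)
Definition partial_L (R : realType) (i : nat) (L : R -> 'rV[R]_4 -> R)
    (t : R) (u : 'rV[R]_4) : R :=
  'D_(delta_mx 0 (inord (i - 2))) (L t) u.

Definition jet (R : realType) (q w : R) (I : set R) (a b : R) (y : R -> R)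
    (t : R) : 'rV[R]_4 :=
  \row_(j < 4) [:: y (q * t + w); hahn q w I y t; y a; y b]`_j.

Definition along (R : realType) (q w : R) (I : set R) (a b : R)
    (L : R -> 'rV[R]_4 -> R) (y : R -> R) (t : R) : R :=
  L t (jet q w I a b y t).

Definition unif_derivable0 (R : realType) (T : set R) (g : R -> R -> R) : Prop :=
  forall eta : R, 0 < eta -> exists2 delta : R, 0 < delta &
    forall e : R, 0 < `|e| < delta -> forall t, T t ->
      `|(g t e - g t 0) / e - derive1 (g t) 0| < eta.

Definition variation_along (R : realType) (q w : R) (I : set R) (a b : R)
    (L : R -> 'rV[R]_4 -> R) (y h : R -> R) (t e : R) : R :=
  along q w I a b L (fun s => y s + e * h s) t.

Definition hahn_functional (R : realType) (q w : R) (I : set R) (a b : R)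
    (L : R -> 'rV[R]_4 -> R) (y : R -> R) : R :=
  hahn_int q w a b (along q w I a b L y).

(* None stands for a free end-point value.                                     *)
Definition end_condition (R : realType) (c : option R) (v : R) : Prop :=
  if c is Some x then v = x else True.

Definition admissible (R : realType) (q w : R) (I : set R) (a b : R)
    (alpha beta : option R) (y : R -> R) : Prop :=
  [/\ in_Y q w I a b 1 y, end_condition alpha (y a)
    & end_condition beta (y b)].

Definition local_minimizer (R : realType) (q w : R) (I : set R) (a b : R)
    (L : R -> 'rV[R]_4 -> R) (alpha beta : option R) (y0 : R -> R) : Prop :=
  admissible q w I a b alpha beta y0 /\
  exists2 delta : R, 0 < delta &
    forall y, admissible q w I a b alpha beta y ->
      Y_norm q w I a b 1 (fun s => y0 s - y s) < delta ->
      hahn_functional q w I a b L y0 <= hahn_functional q w I a b L y.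

Definition local_maximizer (R : realType) (q w : R) (I : set R) (a b : R)
    (L : R -> 'rV[R]_4 -> R) (alpha beta : option R) (y0 : R -> R) : Prop :=
  admissible q w I a b alpha beta y0 /\
  exists2 delta : R, 0 < delta &
    forall y, admissible q w I a b alpha beta y ->
      Y_norm q w I a b 1 (fun s => y0 s - y s) < delta ->
      hahn_functional q w I a b L y <= hahn_functional q w I a b L y0.

(* Main.v *)
Require Import Defs.
From HB Require Import structures.
From mathcomp Require Import all_boot all_order all_algebra.
From mathcomp Require Import all_classical all_reals all_analysis.
From mathcomp Require Import ring lra.

Set Implicit Arguments.
Unset Strict Implicit.
Unset Printing Implicit Defensive.

Import Order.TTheory GRing.Theory Num.Theory.
Import numFieldNormedType.Exports.

Local Open Scope classical_set_scope.
Local Open Scope ring_scope.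

(** The argument is the classical one: the first variation of the functional
    vanishes in every admissible direction, an integration by parts turns it
    into an Euler-Lagrange term plus boundary terms, and suitable directions
    isolate each of them.

    The orbit of [x] under [t |-> q t + w] contracts geometrically to the fixed
    point [omega0], since its [k]-th point is [omega0 + q ^+ k * (x - omega0)].
    Hence the integral from [omega0] to [x] is a sum along this orbit with the
    weights [(1 - q) * (x - omega0) * q ^+ k] of total mass [x - omega0].  It
    exists as soon as the integrand is continuous at [omega0], and it is bounded
    by [|x - omega0|] times the supremum of the integrand on the orbit.  This
    bound and the uniform differentiability in [e] allow differentiation under
    the integral sign ([cvg_functional_quotient]); if [h] is zero at the
    prescribed end points, then [y + e h] is admissible and close to
    [y] for small [e], so the derivative at [e = 0] is zero ([first_variation_eq0]).

    Telescoping the difference quotients along an orbit integrates the product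
    rule for the Hahn derivative ([hahn_int0_by_parts]); the terms at [omega0]
    coming from the two end points cancel.  So the first variation in the
    direction [h] equals the integral of [E(t) * h (q * t + w)], with [E] the
    Euler-Lagrange expression, plus two terms proportional to [h a] and [h b]
    ([hahn_int_first_variation]).

    Take for [h] the indicator function of the single point number [n + 1] of
    the orbit of [a] or [b].  It is constant near [omega0], so it is a
    legitimate direction, and the integral of [E(t) * h (q * t + w)] reduces to
    the weight of point number [n] times the value of [E] there; the other orbit
    contributes nothing because the two orbits are disjoint.  Hence [E] vanishes
    on both orbits ([euler_lagrange_orbit]), and at [omega0] by continuity.  What
    is left of the first variation is linear in [(h a, h b)], and the affine
    directions taking the values [(1, 0)] and [(0, 1)] at [(a, b)] give the two
    natural boundary conditions. *)

(** * Orbits of the map t |-> q t + w *)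

Section Orbit.
Variables (R : realType) (q w : R).
Hypothesis hq : 0 < q < 1.
Notation w0 := (omega0 q w).

(** Point number [k] of the orbit of [x], in a form that shows the geometric
    contraction to the fixed point [w0]. *)
Definition orbit_pt (x : R) (k : nat) : R := w0 + q ^+ k * (x - w0).

Lemma q1_neq0 : 1 - q != 0.
Proof. by rewrite subr_eq0 gt_eqF//; case/andP: hq. Qed.

Lemma q_neq0 : q != 0.
Proof. by rewrite gt_eqF//; case/andP: hq. Qed.

Lemma omega0_fixed : q * w0 + w = w0.
Proof. by rewrite /omega0; field; exact: q1_neq0. Qed.

Lemma hahn_step_sub t : q * t + w - w0 = q * (t - w0).
Proof. by rewrite -{1}omega0_fixed; ring. Qed.

Lemma hahn_denomE t : (q - 1) * t + w = (q - 1) * (t - w0).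
Proof. by rewrite /omega0; field; exact: q1_neq0. Qed.

Lemma orbit_ptE x k : x * q ^+ k + w * qnum q k = orbit_pt x k.
Proof. by rewrite /orbit_pt /qnum /omega0; field; exact: q1_neq0. Qed.

Lemma orbit_pt0 x : orbit_pt x 0 = x.
Proof. by rewrite /orbit_pt expr0 mul1r addrC subrK. Qed.

Lemma orbit_ptS x k : q * orbit_pt x k + w = orbit_pt x k.+1.
Proof.
by apply: (@addIr _ (- w0)); rewrite hahn_step_sub /orbit_pt exprS; ring.
Qed.

Lemma orbit_pt_sub x k : orbit_pt x k - w0 = q ^+ k * (x - w0).
Proof. by rewrite /orbit_pt addrC addKr. Qed.

Lemma orbit_pt_neq x k : x != w0 -> orbit_pt x k != w0.
Proof.
move=> xw; rewrite -subr_eq0 orbit_pt_sub mulf_neq0 ?expf_neq0 ?q_neq0//.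
by rewrite subr_eq0.
Qed.

Lemma orbit_pt_inj x : x != w0 -> injective (orbit_pt x).
Proof.
move=> xw m n /addrI /mulIf; rewrite subr_eq0 => /(_ xw) e.
have /andP[q0 q1] := hq.
by apply/eqP; rewrite eqn_leq -!(ler_iXn2l q0 q1) e lexx.
Qed.

Lemma hahn_orbitP x : hahn_orbit q w x = range (orbit_pt x).
Proof.
by rewrite /hahn_orbit; apply: eq_imagel => n _; rewrite mulrC orbit_ptE.
Qed.

Lemma cvg_orbit_pt x : orbit_pt x @ \oo --> w0.
Proof.
rewrite /orbit_pt -[X in _ --> X]addr0; apply: cvgD; first exact: cvg_cst.
rewrite -(mul0r (x - w0)); apply: cvgMr_tmp; apply: cvg_expr.
by case/andP: hq => q0 q1; rewrite gtr0_norm.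
Qed.

Section WithinI.
Variable (I : set R).
Hypotheses (hI : is_interval I) (hI0 : I w0).

Lemma orbit_pt_in x k : I x -> I (orbit_pt x k).
Proof.
move=> Ix; have /andP[q0 q1] := hq.
have [e0 e1] : 0 <= q ^+ k /\ q ^+ k <= 1.
  by split; [apply: exprn_ge0; exact: ltW|apply: exprn_ile1; exact: ltW].
rewrite /orbit_pt; have [xw|wx] := leP x w0.
  by apply: (hI Ix hI0); apply/andP; split; nra.
by apply: (hI hI0 Ix); apply/andP; split; nra.
Qed.

(** Transfers continuity at [w0] within [I] to convergence along orbits, which is
    the only way in which the integrals see it. *)
Lemma cvg_orbit_within (f : R -> R) x : I x ->
  continuous_within_at I f w0 -> (f \o orbit_pt x) @ \oo --> f w0.
Proof.
move=> Ix cf.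
apply: (@cvg_comp _ _ _ (orbit_pt x) f _ (within I (nbhs w0))) => // U /= IU.
near=> k; suff : I (orbit_pt x k) -> U (orbit_pt x k).
  by apply; exact: orbit_pt_in.
near: k.
exact: cvg_orbit_pt IU.
Unshelve. all: by end_near. Qed.

(** The orbit of [x] consists of points of [I] other than [w0] that accumulate
    at [w0]; so the limits defining the derivative at [w0] are unique even if [w0]
    is an end point of [I]. *)
Lemma within_dnbhs_proper x : I x -> x != w0 -> ProperFilter (within I w0^').
Proof.
move=> Ix xw; apply: Build_ProperFilter_ex => U /= IU.
have [N _ /(_ N (leqnn _)) p] : \forall k \near \oo, orbit_pt x k != w0 ->
    I (orbit_pt x k) -> U (orbit_pt x k).
  exact: (cvg_orbit_pt x IU).
by exists (orbit_pt x N); apply: p; [exact: orbit_pt_neq|exact: orbit_pt_in].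
Qed.

End WithinI.

End Orbit.

(** * The q,w-integral as a weighted sum along an orbit *)

Section Integral.
Variables (R : realType) (q w : R).
Hypothesis hq : 0 < q < 1.
Notation w0 := (omega0 q w).
Notation orbit_pt := (orbit_pt q w).
Implicit Types (f g u h : R -> R) (x : R).

Lemma hahn_seriesE f x :
  hahn_series q w f x = [series q ^+ k * f (orbit_pt x k)]_k.
Proof.
by apply/funext => n; apply: eq_bigr => k _ /=; rewrite (orbit_ptE w hq).
Qed.

Lemma eq_hahn_series f g x : (forall k, f (orbit_pt x k) = g (orbit_pt x k)) ->
  hahn_series q w f x = hahn_series q w g x.
Proof.
by move=> fg; rewrite !hahn_seriesE; apply/funext => n; apply: eq_bigr => k _ /=;
  rewrite fg.
Qed.

Lemma hahn_int_weightE x : x * (1 - q) - w = (1 - q) * (x - w0).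
Proof. by rewrite /omega0; field; exact: q1_neq0. Qed.

Lemma hahn_int0E f x :
  hahn_int0 q w f x = (1 - q) * (x - w0) * limn (hahn_series q w f x).
Proof. by rewrite /hahn_int0 hahn_int_weightE. Qed.

Lemma eq_hahn_int0 f g x : (forall k, f (orbit_pt x k) = g (orbit_pt x k)) ->
  hahn_int0 q w f x = hahn_int0 q w g x.
Proof. by move=> fg; rewrite /hahn_int0 (eq_hahn_series fg). Qed.

Lemma hahn_int0_omega0 f : hahn_int0 q w f w0 = 0.
Proof. by rewrite hahn_int0E subrr mulr0 mul0r. Qed.

Lemma hahn_seriesD f g x : hahn_series q w (fun t => f t + g t) x =
  hahn_series q w f x + hahn_series q w g x.
Proof.
apply/funext => n; rewrite /hahn_series /series /= fctE -big_split /=.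
by apply: eq_bigr => k _; rewrite mulrDr.
Qed.

Lemma hahn_seriesZ c f x : hahn_series q w (fun t => c * f t) x =
  c *: hahn_series q w f x.
Proof.
apply/funext => n; rewrite /hahn_series /series /= fctE /GRing.scale /= mulr_sumr.
by apply: eq_bigr => k _; rewrite mulrCA.
Qed.

Lemma hahn_int0_existsD f g x :
  hahn_int0_exists q w f x -> hahn_int0_exists q w g x ->
  hahn_int0_exists q w (fun t => f t + g t) x.
Proof. by rewrite /hahn_int0_exists hahn_seriesD => cf cg; exact: is_cvgD. Qed.

Lemma hahn_int0_existsZ c f x : hahn_int0_exists q w f x ->
  hahn_int0_exists q w (fun t => c * f t) x.
Proof. by rewrite /hahn_int0_exists hahn_seriesZ => cf; exact: is_cvgZl_tmp. Qed.

Lemma hahn_int0D f g x :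
  hahn_int0_exists q w f x -> hahn_int0_exists q w g x ->
  hahn_int0 q w (fun t => f t + g t) x = hahn_int0 q w f x + hahn_int0 q w g x.
Proof. by move=> cf cg; rewrite /hahn_int0 hahn_seriesD limD// mulrDr. Qed.

Lemma hahn_int0Z c f x : hahn_int0_exists q w f x ->
  hahn_int0 q w (fun t => c * f t) x = c * hahn_int0 q w f x.
Proof.
by move=> cf; rewrite /hahn_int0 hahn_seriesZ limZl_tmp// [LHS]mulrCA.
Qed.

Let q_norm : `|q| < 1.
Proof. by case/andP: hq => q0 q1; rewrite gtr0_norm. Qed.

Let qk_ge0 k : 0 <= q ^+ k.
Proof. by apply: exprn_ge0; case/andP: hq => /ltW. Qed.

Let cvg_normed_bounded f x M : (forall k, `|f (orbit_pt x k)| <= M) ->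
  cvgn [normed [series q ^+ k * f (orbit_pt x k)]_k].
Proof.
move=> fM; apply: (@series_le_cvg _ _ (geometric M q)).
- by move=> n; exact: normr_ge0.
- by move=> n; apply: mulr_ge0 => //; exact: le_trans (fM 0%N).
- by move=> n /=; rewrite normrM (ger0_norm (qk_ge0 n)) mulrC ler_wpM2r.
- exact: is_cvg_geometric_series.
Qed.

(** Comparison with the geometric series of ratio [q]. *)
Lemma hahn_int0_exists_bounded f x M :
  (forall k, `|f (orbit_pt x k)| <= M) -> hahn_int0_exists q w f x.
Proof.
move=> fM; rewrite /hahn_int0_exists hahn_seriesE; apply: normed_cvg.
exact: cvg_normed_bounded fM.
Qed.

(** The weights [(1 - q) * |x - w0| * q ^+ k] sum to [|x - w0|]. *)
Lemma hahn_int0_bound f x M : (forall k, `|f (orbit_pt x k)| <= M) ->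
  `|hahn_int0 q w f x| <= `|x - w0| * M.
Proof.
move=> fM; have /andP[q0 q1] := hq.
rewrite hahn_int0E !normrM [`|1 - q|]gtr0_norm ?subr_gt0//.
have : `|limn (hahn_series q w f x)| <= M / (1 - q).
  rewrite hahn_seriesE; apply: le_trans (lim_series_norm (cvg_normed_bounded fM)) _.
  rewrite -(cvg_lim _ (@cvg_geometric_series _ M q q_norm)) //.
  apply: lim_series_le.
  - exact: cvg_normed_bounded fM.
  - exact: is_cvg_geometric_series.
  - by move=> n /=; rewrite normrM (ger0_norm (qk_ge0 n)) mulrC ler_wpM2r.
rewrite ler_pdivlMr ?subr_gt0// => lM.
by rewrite [_ * `|x - _|]mulrC -mulrA ler_wpM2l// mulrC.
Qed.

Lemma hahn_int0_exists_cvg f x :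
  cvgn (f \o orbit_pt x) -> hahn_int0_exists q w f x.
Proof.
move=> /cvg_seq_bounded/pinfty_ex_gt0[M _ fM].
by apply: (@hahn_int0_exists_bounded _ _ M) => k; exact: fM.
Qed.

Section WithinI.
Variable (I : set R).
Hypotheses (hI : is_interval I) (hI0 : I w0).

Lemma hahn_int0_exists_continuous f x : I x ->
  continuous_within_at I f w0 -> hahn_int0_exists q w f x.
Proof.
move=> Ix cf; apply: hahn_int0_exists_cvg.
by apply: cvgP; exact: (cvg_orbit_within hq hI hI0 Ix cf).
Qed.

Lemma hahn_orbit_pt f x k : x != w0 -> hahn q w I f (orbit_pt x k) =
  (f (orbit_pt x k.+1) - f (orbit_pt x k)) / ((q - 1) * (q ^+ k * (x - w0))).
Proof.
move=> xw; rewrite /hahn (negbTE (orbit_pt_neq hq k xw)).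
by rewrite hahn_denomE// orbit_pt_sub orbit_ptS.
Qed.

(** The integrand is the Hahn derivative of the product [u h].  The weight of an
    orbit point cancels the denominator of the difference quotient taken there, so
    the sum telescopes, and its last term tends to [u w0 * h w0]. *)
Lemma hahn_int0_by_parts u h x : I x ->
  continuous_within_at I u w0 -> continuous_within_at I h w0 ->
  hahn_int0 q w (fun t => hahn q w I u t * h (q * t + w) + u t * hahn q w I h t) x
  = u x * h x - u w0 * h w0.
Proof.
move=> Ix cu ch; have [->|xw] := eqVneq x w0.
  by rewrite hahn_int0_omega0 subrr.
have xw' : x - w0 != 0 by rewrite subr_eq0.
have q1' : 1 - q != 0 by exact: q1_neq0.
rewrite hahn_int0E; set F := fun t : R => _.
pose uh k := u (orbit_pt x k) * h (orbit_pt x k).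
have cuh : uh @ \oo --> u w0 * h w0.
  apply: (@cvgM _ _ _ _ (u \o orbit_pt x) (h \o orbit_pt x)).
    exact: cvg_orbit_within cu.
  exact: cvg_orbit_within ch.
have -> : hahn_series q w F x =
    ((1 - q) * (x - w0))^-1 *: (fun n => u x * h x - uh n).
  rewrite hahn_seriesE; apply/funext => n; rewrite /series /= fctE.
  under eq_bigr => k _.
    rewrite /F !hahn_orbit_pt// orbit_ptS//.
    have -> : q ^+ k * ((u (orbit_pt x k.+1) - u (orbit_pt x k)) /
      ((q - 1) * (q ^+ k * (x - w0))) * h (orbit_pt x k.+1) +
      u (orbit_pt x k) * ((h (orbit_pt x k.+1) - h (orbit_pt x k)) /
      ((q - 1) * (q ^+ k * (x - w0))))) =
      - ((1 - q) * (x - w0))^-1 * (uh k.+1 - uh k).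
      rewrite /uh; field; rewrite xw' q1' expf_neq0 ?(q_neq0 hq)//=.
      by rewrite -opprB oppr_eq0.
    over.
  rewrite -mulr_sumr telescope_sumr//= mulNr -mulrN opprB.
  by rewrite [uh 0%N]/uh !orbit_pt0.
rewrite (cvg_lim _ (_ : _ @ \oo --> 
  ((1 - q) * (x - w0))^-1 *: (u x * h x - u w0 * h w0)))//; last first.
  by apply: cvgZl_tmp; apply: cvgB => //; exact: cvg_cst.
by rewrite /GRing.scale /= mulrA divff ?mul1r// mulf_neq0.
Qed.

End WithinI.

(** The partial sums are constant from index [n + 1] on. *)
Lemma hahn_int0_single f x n :
  (forall k, k != n -> f (orbit_pt x k) = 0) ->
  hahn_int0 q w f x = (1 - q) * (x - w0) * (q ^+ n * f (orbit_pt x n)).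
Proof.
move=> f0; rewrite hahn_int0E; congr (_ * _); apply: cvg_lim => //.
apply: cvg_near_cst; near=> N; rewrite hahn_seriesE /series /=.
have nN : (n < N)%N by near: N; exact: nbhs_infty_gt.
rewrite big_mkord (bigD1 (Ordinal nN)) //= big1 ?addr0// => k kn.
by rewrite f0 ?mulr0//.
Unshelve. all: by end_near. Qed.

End Integral.

(** * The space of test functions *)

Section Space.
Variables (R : realType) (q w : R) (I : set R) (a b : R).
Hypotheses (hq : 0 < q < 1) (hI : is_interval I) (hI0 : I (omega0 q w)).
Hypotheses (hIa : I a) (hIb : I b) (hab : a < b).
Notation w0 := (omega0 q w).
Notation Y1 := (in_Y q w I a b 1).
Implicit Types (f g y h : R -> R) (x : R).

(** At least one of [a] and [b] differs from [w0]. *)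
Lemma punctured_within_proper : ProperFilter (within I w0^').
Proof.
have [aw|aw] := eqVneq a w0; last exact: (within_dnbhs_proper hq hI hI0 hIa).
by apply: (within_dnbhs_proper hq hI hI0 hIb); rewrite -aw gt_eqF.
Qed.
#[local] Existing Instance punctured_within_proper.

Lemma bounded_itvP f : [bounded f t | t in `[a, b]] <->
  exists M, forall t, `[a, b]%classic t -> `|f t| <= M.
Proof.
split=> [/pinfty_ex_gt0[M _ fM]|[M fM]]; first by exists M.
by exists M; split; [exact: num_real|move=> N MN t /fM /le_trans; apply; exact: ltW].
Qed.

Lemma in_Y1P y : Y1 y <->
  [/\ derivable_within I y w0,
      exists M, forall t, `[a, b]%classic t -> `|y t| <= M,
      continuous_within_at I y w0,
      exists M, forall t, `[a, b]%classic t -> `|hahn q w I y t| <= M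
    & continuous_within_at I (hahn q w I y) w0].
Proof.
split=> [[dy cy]|[dy by_ cy bhy chy]].
  have [/bounded_itvP ? ?] := cy 0%N isT; have [/bounded_itvP ? ?] := cy 1%N isT.
  by split=> //; exact: (dy 0%N isT).
by split=> [[|//] _|[|[|//]] _] //; split=> //; apply/bounded_itvP.
Qed.

Lemma cvg_diff_quotient_line y h e :
  derivable_within I y w0 -> derivable_within I h w0 ->
  diff_quotient (fun s => y s + e * h s) w0 @ within I w0^' -->
    derive_within I y w0 + e * derive_within I h w0.
Proof.
move=> dy dh.
rewrite (_ : diff_quotient _ _ =
  (fun t => diff_quotient y w0 t + e * diff_quotient h w0 t)); last first.
  by apply/funext => t; rewrite /diff_quotient; ring.
by apply: cvgD => //; apply: cvgMl_tmp.
Qed.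

Lemma derivable_within_line y h e :
  derivable_within I y w0 -> derivable_within I h w0 ->
  derivable_within I (fun s => y s + e * h s) w0.
Proof. by move=> dy dh; apply: cvgP; exact: cvg_diff_quotient_line. Qed.

Lemma hahn_line y h e :
  derivable_within I y w0 -> derivable_within I h w0 ->
  hahn q w I (fun s => y s + e * h s) =
  (fun t => hahn q w I y t + e * hahn q w I h t).
Proof.
move=> dy dh; apply/funext => t; rewrite /hahn; case: ifPn => tw; last by ring.
by apply: cvg_lim => //; exact: cvg_diff_quotient_line.
Qed.

Lemma continuous_within_line y h e x :
  continuous_within_at I y x -> continuous_within_at I h x ->
  continuous_within_at I (fun s => y s + e * h s) x.
Proof. by move=> cy ch; apply: cvgD => //; apply: cvgMl_tmp. Qed.

Lemma bounded_line (A : set R) y h e :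
  (exists M, forall t, A t -> `|y t| <= M) ->
  (exists M, forall t, A t -> `|h t| <= M) ->
  exists M, forall t, A t -> `|y t + e * h t| <= M.
Proof.
move=> [M yM] [N hN]; exists (M + `|e| * N) => t At.
by rewrite (le_trans (ler_normD _ _))// lerD ?yM// normrM ler_wpM2l ?hN.
Qed.

Lemma in_Y1_line y h e : Y1 y -> Y1 h -> Y1 (fun s => y s + e * h s).
Proof.
move=> /in_Y1P[dy ? ? ? ?] /in_Y1P[dh ? ? ? ?]; apply/in_Y1P.
rewrite hahn_line//; split; [exact: derivable_within_line|exact: bounded_line
  |exact: continuous_within_line|exact: bounded_line
  |exact: continuous_within_line].
Qed.

Lemma sup_norm_le f M : (forall t, `[a, b]%classic t -> `|f t| <= M) ->
  sup_norm a b f <= M.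
Proof.
move=> fM; apply: ge_sup => [|_ [t abt <-]]; last exact: fM.
by exists `|f a|, a => //=; rewrite in_itv /= lexx ltW.
Qed.

Lemma derive_within_near f c :
  (\forall t \near within I w0^', diff_quotient f w0 t = c) ->
  derivable_within I f w0 /\ derive_within I f w0 = c.
Proof.
move=> fc; have fc' : diff_quotient f w0 @ within I w0^' --> c.
  exact: cvg_near_cst.
by split; [apply/cvg_ex; exists c|exact: cvg_lim].
Qed.

Lemma derive_within_affine c d :
  derivable_within I (fun t => c + d * t) w0 /\
  derive_within I (fun t => c + d * t) w0 = d.
Proof.
apply: derive_within_near; rewrite near_withinE.
apply: filterS (nbhs_dnbhs_neq w0) => t tw _.
have tw' : t - w0 != 0 by rewrite subr_eq0.
by rewrite /diff_quotient; field.
Qed.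

Lemma hahn_affine c d : hahn q w I (fun t => c + d * t) = (fun=> d).
Proof.
apply/funext => t; rewrite /hahn; have [_|tw] := eqVneq t w0.
  by have [] := derive_within_affine c d.
rewrite hahn_denomE//.
have tw' : t - w0 != 0 by rewrite subr_eq0.
have q1' : q - 1 != 0 by rewrite -oppr_eq0 opprB (q1_neq0 hq).
have -> : c + d * (q * t + w) - (c + d * t) = d * ((q - 1) * (t - w0)).
  by rewrite -hahn_denomE//; ring.
by rewrite mulfK// mulf_neq0.
Qed.

(** The norm is homogeneous, so small parameters [e] give functions close to
    [y]. *)
Lemma Y_norm_line y h : Y1 h -> exists C, forall e,
  Y_norm q w I a b 1 (fun s => y s - (y s + e * h s)) <= `|e| * C.
Proof.
move=> /in_Y1P[dh [M hM] _ [N hN] _]; exists (M + N) => e.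
rewrite (_ : (fun s => _) = (fun s => (0 + 0 * s) + (- e) * h s)); last first.
  by apply/funext => s; ring.
rewrite /Y_norm big_ord_recl big_ord1 /= hahn_line//; last first.
  by have [] := derive_within_affine 0 0.
rewrite mulrDr lerD//; apply: sup_norm_le => t abt.
  by rewrite mul0r !add0r normrM normrN ler_wpM2l ?hM.
by rewrite hahn_affine add0r normrM normrN ler_wpM2l ?hN.
Qed.

(** Affine directions prescribe the two end-point values independently. *)
Lemma in_Y1_affine c d : Y1 (fun t => c + d * t).
Proof.
apply/in_Y1P; rewrite hahn_affine; split.
- by have [] := derive_within_affine c d.
- exists (`|c| + `|d| * (`|a| + `|b|)) => t /=; rewrite in_itv /= => /andP[at_ tb].
  rewrite (le_trans (ler_normD _ _))// lerD// normrM ler_wpM2l//.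
  rewrite ler_norml; have := ler_norm b; have := ler_norm (- a).
  rewrite normrN; have := normr_ge0 a; have := normr_ge0 b; lra.
- apply: cvg_within_filter; apply: cvgD; first exact: cvg_cst.
  by apply: cvgMl_tmp; exact: cvg_id.
- by exists `|d|.
- exact: cvg_cst.
Qed.

Definition spike (p t : R) : R := (t == p)%:R.

Lemma spike_near0 p t : `|t - w0| < `|p - w0| -> spike p t = 0.
Proof. by rewrite /spike; case: eqP => // ->; rewrite ltxx. Qed.

(** Ensures that the Hahn quotient of a function vanishing in a ball around [w0]
    vanishes there as well. *)
Lemma hahn_step_contracts t : `|q * t + w - w0| <= `|t - w0|.
Proof.
have /andP[q0 q1] := hq.
by rewrite hahn_step_sub// normrM (gtr0_norm q0) ler_piMl// ltW.
Qed.

Lemma near_omega0 p : p != w0 -> \forall t \near w0, `|t - w0| < `|p - w0|.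
Proof.
move=> pw; have pw' : 0 < `|p - w0| by rewrite normr_gt0 subr_eq0.
by near=> t; rewrite distrC; near: t; exact: (@cvgr_dist_lt _ _ _ (nbhs w0) _ id).
Unshelve. all: by end_near. Qed.

Lemma diff_quotient_spike_near0 p : p != w0 ->
  \forall t \near within I w0^', diff_quotient (spike p) w0 t = 0.
Proof.
move=> pw; rewrite near_withinE; apply: cvg_within.
apply: filterS (near_omega0 pw) => t tp _.
rewrite /diff_quotient !spike_near0// ?subrr ?mul0r// ?normr0 normr_gt0 subr_eq0//.
Qed.

Lemma hahn_spike_near0 p t : `|t - w0| < `|p - w0| -> hahn q w I (spike p) t = 0.
Proof.
move=> tp; rewrite /hahn; case: ifP => _; last first.
  rewrite !spike_near0 ?subrr ?mul0r//.
  exact: le_lt_trans (hahn_step_contracts t) tp.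
apply: (derive_within_near (diff_quotient_spike_near0 _)).2.
by rewrite -subr_eq0 -normr_gt0 (le_lt_trans _ tp).
Qed.

Lemma spike_le1 p t : 0 <= spike p t <= 1.
Proof. by rewrite /spike; case: eqP => _ /=; rewrite !lexx ler01. Qed.

(** Away from [w0] no regularity is required, so an indicator function is
    admissible: near [w0] it vanishes together with its Hahn derivative, and
    elsewhere the denominator of the Hahn quotient is bounded away from zero. *)
Lemma in_Y1_spike p : p != w0 -> Y1 (spike p).
Proof.
move=> pw; have pw' : 0 < `|p - w0| by rewrite normr_gt0 subr_eq0.
have c0 f : (forall t, `|t - w0| < `|p - w0| -> f t = 0) ->
    continuous_within_at I f w0.
  move=> f0; rewrite /continuous_within_at f0 ?subrr ?normr0//.
  apply: cvg_within_filter; apply: cvg_near_cst.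
  by apply: filterS (near_omega0 pw) => t; exact: f0.
apply/in_Y1P; split.
- by have [] := derive_within_near (diff_quotient_spike_near0 pw).
- by exists 1 => t _; have /andP[? ?] := spike_le1 p t; rewrite ger0_norm.
- by apply: c0; exact: spike_near0.
(* A spike takes values in [0, 1], and the denominator of the quotient is
   [(q - 1) * (t - w0)] with [t] outside the ball of radius [|p - w0|]. *)
- exists (1 / ((1 - q) * `|p - w0|)) => t _.
  have /andP[q0 q1] := hq.
  have [/hahn_spike_near0 ->|pt] := ltP `|t - w0| `|p - w0|.
    by rewrite normr0 divr_ge0// mulr_ge0// subr_ge0 ltW.
  have tw : t != w0 by rewrite -subr_eq0 -normr_gt0 (lt_le_trans pw').
  rewrite /hahn (negbTE tw) hahn_denomE// normrM normfV.
  apply: ler_pM => //.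
    have /andP[? ?] := spike_le1 p t.
    have /andP[? ?] := spike_le1 p (q * t + w).
    by rewrite ler_norml; lra.
  rewrite normrM distrC [`|1 - q|]gtr0_norm ?subr_gt0//.
  rewrite lef_pV2 ?posrE ?mulr_gt0 ?subr_gt0//; last exact: lt_le_trans pt.
  by rewrite ler_wpM2l// subr_ge0 ltW.
- by apply: c0 => t; exact: hahn_spike_near0.
Qed.

End Space.

(** * Vanishing of the first variation at an extremizer *)

(** The difference quotients are nonnegative on the right of [0] and nonpositive
    on the left. *)
Lemma critical_at_min (R : realType) (Phi : R -> R) (J : R) :
  (Phi e - Phi 0) / e @[e --> 0^'] --> J ->
  (\forall e \near 0, Phi 0 <= Phi e) -> J = 0.
Proof.
move=> PJ Pmin; apply/eqP; rewrite eq_le; apply/andP; split.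
  have PJl := cvg_dnbhs_at_left PJ.
  rewrite -(cvg_lim _ PJl)//; apply: limr_le; first by apply/cvg_ex; exists J.
  near=> e; rewrite mulr_ge0_le0// ?invr_le0; last by apply/ltW; near: e; exact: nbhs_left_lt.
  by rewrite subr_ge0; near: e; exact: cvg_within.
have PJr := cvg_dnbhs_at_right PJ.
rewrite -(cvg_lim _ PJr)//; apply: limr_ge; first by apply/cvg_ex; exists J.
near=> e; rewrite mulr_ge0// ?invr_ge0; last by apply/ltW; near: e; exact: nbhs_right_gt.
by rewrite subr_ge0; near: e; exact: cvg_within.
Unshelve. all: by end_near. Qed.

Lemma derive1_affine_line (R : realType) n (F : 'rV[R]_n -> R) (U V : 'rV[R]_n) :
  derive1 (fun e : R => F (U + e *: V)) 0 = 'D_V F U.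
Proof.
rewrite /derive1 /derive; under eq_fun do rewrite addr0 scale0r addr0 [U + _]addrC.
by [].
Qed.

Lemma derive_rowE (R : realType) n (F : 'rV[R]_n -> R) (U V : 'rV[R]_n) :
  differentiable F U ->
  'D_V F U = \sum_j V 0 j * 'D_(delta_mx 0 j) F U.
Proof.
move=> dF; rewrite deriveE// {1}(row_sum_delta V) linear_sum.
by apply: eq_bigr => j _; rewrite linearZ deriveE.
Qed.

(** The linearized integrand in the direction [h]: [m0], [m1], [ma], [mb] stand
    for the partial derivatives of the Lagrangian in [y (q t + w)], in the Hahn
    derivative of [y], in [y a] and in [y b].  Keeping them abstract separates the
    linear analysis from the Lagrangian. *)
Definition first_variation (R : realType) (q w : R) (I : set R) (a b : R)
    (m0 m1 ma mb h : R -> R) (t : R) : R :=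
  m0 t * h (q * t + w) + m1 t * hahn q w I h t + ma t * h a + mb t * h b.

Section Variation.
Variables (R : realType) (q w : R) (I : set R) (a b : R).
Variable L : R -> 'rV[R]_4 -> R.
Hypotheses (hq : 0 < q < 1) (hI : is_interval I) (hI0 : I (omega0 q w)).
Hypotheses (hIa : I a) (hIb : I b) (hab : a < b).
Hypothesis H1 : forall t, I t -> C1 (L t).
Notation w0 := (omega0 q w).
Notation Y1 := (in_Y q w I a b 1).
Notation jet := (jet q w I a b).
Notation along := (along q w I a b).
Notation P i y := (along (partial_L i L) y).

Section Direction.
Variables y h : R -> R.
Hypotheses (Yy : Y1 y) (Yh : Y1 h).
Notation g := (variation_along q w I a b L y h).

Lemma jet_line e t : jet (fun s => y s + e * h s) t = jet y t + e *: jet h t.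
Proof.
have [dy _ _ _ _] := (in_Y1P _ _ _ _ _ _).1 Yy.
have [dh _ _ _ _] := (in_Y1P _ _ _ _ _ _).1 Yh.
apply/rowP => j; rewrite !mxE (hahn_line hq hI hI0 hIa hIb hab)//.
by case: j => -[|[|[|[|//]]]] ?.
Qed.

(** Chain rule along the segment: at a fixed [t] the jet of [y + e h] is affine
    in [e], with slope the jet of [h]. *)
Lemma derive1_variation t : I t -> derive1 (g t) 0 =
  first_variation q w I a b (P 2 y) (P 3 y) (P 4 y) (P 5 y) h t.
Proof.
move=> It; rewrite (_ : g t = fun e => L t (jet y t + e *: jet h t)); last first.
  by apply/funext => e; rewrite /variation_along /along jet_line.
rewrite derive1_affine_line derive_rowE; last by have [] := H1 It.
rewrite !big_ord_recl big_ord0 addr0 !mxE /along /partial_L /=.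
(* The coordinates of the jet are indexed from 0, the arguments other than the
   time from 2. *)
have i0 : inord (2 - 2) = ord0 :> 'I_4 by apply/val_inj; rewrite /= inordK.
have i1 : inord (3 - 2) = lift ord0 ord0 :> 'I_4.
  by apply/val_inj; rewrite /= inordK.
have i2 : inord (4 - 2) = lift ord0 (lift ord0 ord0) :> 'I_4.
  by apply/val_inj; rewrite /= inordK.
have i3 : inord (5 - 2) = lift ord0 (lift ord0 (lift ord0 ord0)) :> 'I_4.
  by apply/val_inj; rewrite /= inordK.
rewrite i0 i1 i2 i3 /first_variation; ring.
Qed.

Hypothesis Hi : unif_derivable0 (hahn_interval q w a b) g.
Hypothesis Hii : \forall e \near (0 : R),
  hahn_int0_exists q w (fun t => g t e) a /\
  hahn_int0_exists q w (fun t => g t e) b.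
Hypothesis Hiii : hahn_int0_exists q w (fun t => derive1 (g t) 0) a /\
  hahn_int0_exists q w (fun t => derive1 (g t) 0) b.

Lemma hahn_interval_orbit x k : x = a \/ x = b ->
  hahn_interval q w a b (orbit_pt q w x k).
Proof.
by case=> ->; left; [left|right]; rewrite hahn_orbitP//; exists k.
Qed.

(** Differentiation under the integral sign: the error of the difference quotient
    is uniform over the orbits, and each integral is bounded by the supremum of
    its integrand times the total mass of its weights. *)
Lemma cvg_functional_quotient :
  (hahn_functional q w I a b L (fun s => y s + e * h s) -
   hahn_functional q w I a b L (fun s => y s + 0 * h s)) / e @[e --> 0^'] -->
  hahn_int q w a b (fun t => derive1 (g t) 0).
Proof.
apply/cvgrPdist_le => eps eps0.
(* The total mass of the weights of both orbits; adding 1 keeps it positive. *)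
pose C := `|a - w0| + `|b - w0| + 1.
have C0 : 0 < C by rewrite ltr_wpDl// addr_ge0.
have [delta d0 Hd] := Hi (divr_gt0 eps0 C0).
have [ea0 eb0] := nbhs_singleton Hii.
have [ja jb] := Hiii.
near=> e.
have e0 : e != 0 by near: e; exact: nbhs_dnbhs_neq.
have ed : 0 < `|e| < delta.
  rewrite normr_gt0 e0 /=; near: e; apply: cvg_within.
  by near=> e; rewrite -[e]subr0 distrC; near: e; exact: (@cvgr_dist_lt _ _ _ (nbhs 0) _ id).
have [ea eb] : hahn_int0_exists q w (fun t => g t e) a /\
   hahn_int0_exists q w (fun t => g t e) b.
  by near: e; apply: cvg_within.
have key x : x = a \/ x = b -> hahn_int0_exists q w (fun t => g t 0) x ->
    hahn_int0_exists q w (fun t => derive1 (g t) 0) x ->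
    hahn_int0_exists q w (fun t => g t e) x ->
    `|hahn_int0 q w (fun t => derive1 (g t) 0) x -
      (hahn_int0 q w (fun t => g t e) x - hahn_int0 q w (fun t => g t 0) x) / e|
    <= `|x - w0| * (eps / C).
  move=> xab ex0 jx ex.
  have -> : hahn_int0 q w (fun t => derive1 (g t) 0) x -
      (hahn_int0 q w (fun t => g t e) x - hahn_int0 q w (fun t => g t 0) x) / e
    = hahn_int0 q w (fun t => derive1 (g t) 0 +
        (- e^-1) * (g t e + (-1) * g t 0)) x.
    have en : hahn_int0_exists q w (fun t => -1 * g t 0) x.
      exact: hahn_int0_existsZ.
    have es := hahn_int0_existsD ex en.
    rewrite hahn_int0D//; last exact: hahn_int0_existsZ.
    by rewrite hahn_int0Z// hahn_int0D// hahn_int0Z//; ring.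
  apply: hahn_int0_bound => // k.
  have := Hd _ ed _ (hahn_interval_orbit k xab).
  by rewrite distrC => /ltW; congr (`|_| <= _); ring.
rewrite /hahn_functional /hahn_int.
have Ka := key a (or_introl erefl) ea0 ja ea.
have Kb := key b (or_intror erefl) eb0 jb eb.
have Cle : `|a - w0| * (eps / C) + `|b - w0| * (eps / C) <= eps.
  rewrite -mulrDl mulrCA ger_pMr// ler_pdivrMr// mul1r /C; lra.
apply: le_trans Cle; rewrite [leRHS]addrC.
apply: le_trans (lerD Kb Ka); apply: le_trans (ler_normB _ _).
rewrite le_eqVlt; apply/orP; left; apply/eqP; congr (`|_|).
rewrite /variation_along; ring.
Unshelve. all: by end_near. Qed.

End Direction.

Hypothesis Hi : forall y h, Y1 y -> Y1 h ->
  unif_derivable0 (hahn_interval q w a b) (variation_along q w I a b L y h).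
Hypothesis Hii : forall y h, Y1 y -> Y1 h -> \forall e \near (0 : R),
  hahn_int0_exists q w (fun t => variation_along q w I a b L y h t e) a /\
  hahn_int0_exists q w (fun t => variation_along q w I a b L y h t e) b.
Hypothesis Hiii : forall y h, Y1 y -> Y1 h ->
  hahn_int0_exists q w (fun t => derive1 (variation_along q w I a b L y h t) 0) a /\
  hahn_int0_exists q w (fun t => derive1 (variation_along q w I a b L y h t) 0) b.

Variables (alpha beta : option R) (y : R -> R).
Hypothesis Hext : local_minimizer q w I a b L alpha beta y \/
                  local_maximizer q w I a b L alpha beta y.

Lemma admissible_line h e : admissible q w I a b alpha beta y -> Y1 h ->
  (alpha <> None -> h a = 0) -> (beta <> None -> h b = 0) ->
  admissible q w I a b alpha beta (fun s => y s + e * h s).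
Proof.
move=> [Yy ya yb] Yh ha hb; split; first exact: in_Y1_line.
  by case: alpha ya ha => //= c -> ->//; rewrite mulr0 addr0.
by case: beta yb hb => //= c -> ->//; rewrite mulr0 addr0.
Qed.

Lemma near_Y_norm_line h delta : Y1 h -> 0 < delta ->
  \forall e \near (0 : R),
    Y_norm q w I a b 1 (fun s => y s - (y s + e * h s)) < delta.
Proof.
move=> Yh d0; have [C hC] := Y_norm_line hq hI hI0 hIa hIb hab y Yh.
have K0 : 0 < `|C| + 1 by rewrite ltr_wpDl.
near=> e; apply: le_lt_trans (hC e) _.
have : `|e| < delta / (`|C| + 1).
  near: e; near=> e; rewrite -[e]subr0 distrC; near: e.
  by apply: (@cvgr_dist_lt _ _ _ (nbhs 0) _ id) => //; exact: divr_gt0.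
rewrite ltr_pdivlMr//; apply: le_lt_trans.
by rewrite ler_wpM2l// (le_trans (ler_norm _))// lerDl.
Unshelve. all: by end_near. Qed.

Lemma extremizer_admissible : admissible q w I a b alpha beta y.
Proof. by case: Hext => -[]. Qed.

(** A maximizer of the functional is a minimizer of its opposite, so one sign is
    enough. *)
Lemma first_variation_eq0 h : Y1 h ->
  (alpha <> None -> h a = 0) -> (beta <> None -> h b = 0) ->
  hahn_int q w a b (first_variation q w I a b (P 2 y) (P 3 y) (P 4 y) (P 5 y) h)
  = 0.
Proof.
move=> Yh ha hb; have Ay := extremizer_admissible; have [Yy _ _] := Ay.
have dE x : x = a \/ x = b ->
    hahn_int0 q w (first_variation q w I a b (P 2 y) (P 3 y) (P 4 y) (P 5 y) h) x
    = hahn_int0 q w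
        (fun t => derive1 (variation_along q w I a b L y h t) 0) x.
  move=> xab; apply: eq_hahn_int0 => // k; apply/esym.
  apply: derive1_variation => //; apply: orbit_pt_in => //.
  by case: xab => ->.
rewrite /hahn_int !dE; [|by left|by right].
rewrite -/(hahn_int q w a b _).
have Q := cvg_functional_quotient (Hi Yy Yh) (Hii Yy Yh) (Hiii Yy Yh).
(* The quotient is stated at [y + 0 h], which is [y] only propositionally. *)
have y0 : (fun s => y s + 0 * h s) = y by apply/funext => s; rewrite mul0r addr0.
case: Hext => -[_ [delta d0 ext]].
  apply: (critical_at_min Q); apply: filterS (near_Y_norm_line Yh d0) => e ne.
  by rewrite y0; apply: ext => //; exact: admissible_line.
apply/eqP; rewrite -oppr_eq0; apply/eqP.
pose Phi e := - hahn_functional q w I a b L (fun s => y s + e * h s).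
apply: (@critical_at_min _ Phi).
  rewrite (_ : (fun e => _) = (fun e => - ((- Phi e - - Phi 0) / e))); last first.
    by apply/funext => e; ring.
  by rewrite /Phi; under eq_fun do rewrite !opprK; exact: cvgN.
apply: filterS (near_Y_norm_line Yh d0) => e ne.
by rewrite /Phi y0 lerN2; apply: ext => //; exact: admissible_line.
Qed.

End Variation.

(** * From the first variation to the Euler-Lagrange equation *)

Section EulerLagrange.
Variables (R : realType) (q w : R) (I : set R) (a b : R).
Hypotheses (hq : 0 < q < 1) (hI : is_interval I) (hI0 : I (omega0 q w)).
Hypotheses (hIa : I a) (hIb : I b) (hab : a < b).
Notation w0 := (omega0 q w).
Notation Y1 := (in_Y q w I a b 1).
Notation orbit_pt := (orbit_pt q w).
Notation cont := (continuous_within_at I ^~ w0).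

Variables m0 m1 ma mb : R -> R.
Hypotheses (cm0 : cont m0) (cm1 : cont m1) (chm1 : cont (hahn q w I m1)).
Hypotheses (cma : cont ma) (cmb : cont mb).
Notation delta := (first_variation q w I a b m0 m1 ma mb).

Definition euler_lagrange t : R := m0 t - hahn q w I m1 t.

Lemma continuous_euler_lagrange : cont euler_lagrange.
Proof. exact: cvgB. Qed.

Section Test.
Variable h : R -> R.
Hypothesis Yh : Y1 h.
Let ch : continuous_within_at I h w0. Proof. by have /in_Y1P[] := Yh. Qed.
Let chh : continuous_within_at I (hahn q w I h) w0.
Proof. by have /in_Y1P[] := Yh. Qed.

Lemma hahn_int0_exists_shift f x : I x -> continuous_within_at I f w0 ->
  hahn_int0_exists q w (fun t => f t * h (q * t + w)) x.
Proof.
move=> Ix cf; apply: (hahn_int0_exists_cvg hq); apply/cvg_ex.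
exists (f w0 * h w0); rewrite (_ : _ \o _ =
  (fun k => (f \o orbit_pt x) k * (h \o orbit_pt x) k.+1)); last first.
  by apply/funext => k /=; rewrite orbit_ptS.
apply: cvgM; first exact: (cvg_orbit_within hq hI hI0).
rewrite (@cvg_shiftS _ (h \o orbit_pt x)).
exact: (cvg_orbit_within hq hI hI0).
Qed.

(** Adding and subtracting [hahn m1 t * h (q * t + w)] exhibits the integrand of
    the integration by parts. *)
Lemma hahn_int0_first_variation x : I x ->
  hahn_int0 q w (delta h) x =
  hahn_int0 q w (fun t => euler_lagrange t * h (q * t + w)) x
  + (m1 x * h x - m1 w0 * h w0)
  + h a * hahn_int0 q w ma x + h b * hahn_int0 q w mb x.
Proof.
move=> Ix.
pose F t := euler_lagrange t * h (q * t + w).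
pose G t := hahn q w I m1 t * h (q * t + w) + m1 t * hahn q w I h t.
have -> : delta h = (fun t => F t + G t + h a * ma t + h b * mb t).
  apply/funext => t; rewrite /first_variation /F /G /euler_lagrange; ring.
have exF : hahn_int0_exists q w F x.
  exact: (hahn_int0_exists_shift Ix continuous_euler_lagrange).
have exG : hahn_int0_exists q w G x.
  apply: hahn_int0_existsD; first exact: hahn_int0_exists_shift.
  by apply: (hahn_int0_exists_continuous hq hI hI0 Ix); exact: cvgM.
have exa : hahn_int0_exists q w ma x.
  exact: (hahn_int0_exists_continuous hq hI hI0 Ix).
have exb : hahn_int0_exists q w mb x.
  exact: (hahn_int0_exists_continuous hq hI hI0 Ix).
have exa' : hahn_int0_exists q w (fun t => h a * ma t) x.
  exact: hahn_int0_existsZ.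
have exb' : hahn_int0_exists q w (fun t => h b * mb t) x.
  exact: hahn_int0_existsZ.
have exFG := hahn_int0_existsD exF exG.
rewrite (hahn_int0D (hahn_int0_existsD exFG exa') exb').
rewrite (hahn_int0D exFG exa') (hahn_int0D exF exG) !hahn_int0Z//.
congr (_ + _ + _ + _).
exact: (hahn_int0_by_parts hq hI hI0 Ix cm1 ch).
Qed.

(** The boundary terms [m1 w0 * h w0] of the two end points cancel. *)
Lemma hahn_int_first_variation :
  hahn_int q w a b (delta h) =
  hahn_int q w a b (fun t => euler_lagrange t * h (q * t + w))
  + h a * (hahn_int q w a b ma - m1 a)
  + h b * (hahn_int q w a b mb + m1 b).
Proof. by rewrite /hahn_int !hahn_int0_first_variation//; ring. Qed.

End Test.

Hypothesis horb : hahn_orbit q w a `&` hahn_orbit q w b = set0.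

Lemma orbits_disjoint k l : orbit_pt a k != orbit_pt b l.
Proof.
apply/eqP => abkl.
have : (hahn_orbit q w a `&` hahn_orbit q w b) (orbit_pt a k).
  by rewrite !hahn_orbitP//; split; [exists k|exists l].
by rewrite horb.
Qed.

(** The factor [h (q * t + w)] shifts the orbit by one step: the spike at point
    number [n + 1] selects the value at point number [n]. *)
Lemma hahn_int0_spike x n : x != w0 ->
  hahn_int0 q w (fun t => euler_lagrange t *
    spike (orbit_pt x n.+1) (q * t + w)) x =
  (1 - q) * (x - w0) * (q ^+ n * euler_lagrange (orbit_pt x n)).
Proof.
move=> xw; rewrite (@hahn_int0_single _ _ _ hq _ _ n).
  by rewrite orbit_ptS// /spike eqxx mulr1.
move=> k kn; rewrite orbit_ptS// /spike [_ == _]negbTE ?mulr0//.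
by apply: contra kn => /eqP /(orbit_pt_inj hq xw) [->].
Qed.

Lemma hahn_int0_spike_disjoint x z n : (forall k, orbit_pt z k != orbit_pt x n) ->
  hahn_int0 q w (fun t => euler_lagrange t * spike (orbit_pt x n) (q * t + w)) z
  = 0.
Proof.
move=> xz; rewrite (@hahn_int0_single _ _ _ hq _ _ 0%N) => [|k _].
  by rewrite orbit_ptS// /spike (negbTE (xz _)) !mulr0.
by rewrite orbit_ptS// /spike (negbTE (xz _)) mulr0.
Qed.

Hypothesis stationary : forall h, Y1 h -> h a = 0 -> h b = 0 ->
  hahn_int q w a b (delta h) = 0.

(** The spike at point number [n + 1] of the orbit of [x] vanishes at [a] and [b],
    hence is a direction of variation whatever the end-point conditions are, and
    the first variation in this direction is a nonzero multiple of the value at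
    point number [n]. *)
Lemma euler_lagrange_orbit x n : x = a \/ x = b -> x != w0 ->
  euler_lagrange (orbit_pt x n) = 0.
Proof.
move=> xab xw; have pw : orbit_pt x n.+1 != w0 by exact: orbit_pt_neq.
have Yh := in_Y1_spike hq hI hI0 hIa hIb hab pw.
have pneq z k : z = a \/ z = b -> (z = x -> k != n.+1) ->
    orbit_pt z k != orbit_pt x n.+1.
  have self : (x = x -> k != n.+1) -> orbit_pt x k != orbit_pt x n.+1.
    by move=> /(_ erefl); apply: contra => /eqP /(orbit_pt_inj hq xw) ->.
  by move: xab self => [] -> self [] ->//; rewrite ?[_ == orbit_pt a _]eq_sym orbits_disjoint.
have spike0 z : z = a \/ z = b -> spike (orbit_pt x n.+1) z = 0.
  move=> zab; have := pneq z 0%N zab (fun _ => isT).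
  by rewrite /spike orbit_pt0 => /negbTE ->.
have ha := spike0 a (or_introl erefl); have hb := spike0 b (or_intror erefl).
have := stationary Yh ha hb; rewrite hahn_int_first_variation// ha hb !mul0r !addr0.
have w1 : (1 - q) * (x - w0) != 0.
  by rewrite mulf_neq0 ?subr_eq0// -subr_eq0 (q1_neq0 hq).
have w2 : q ^+ n != 0 by rewrite expf_neq0 ?(q_neq0 hq).
rewrite /hahn_int; case: xab => xE.
  rewrite [X in X - _]hahn_int0_spike_disjoint; last first.
    move=> k; apply: pneq; first by right.
    by move=> bx; move: hab; rewrite bx xE ltxx.
  rewrite -[X in hahn_int0 _ _ _ X]xE hahn_int0_spike// sub0r => /eqP; rewrite oppr_eq0.
  by rewrite !mulf_eq0 (negbTE w2) -!mulf_eq0 mulf_eq0 (negbTE w1) => /eqP.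
rewrite [X in _ - X]hahn_int0_spike_disjoint; last first.
  move=> k; apply: pneq; first by left.
  by move=> bx; move: hab; rewrite bx xE ltxx.
rewrite -[X in hahn_int0 _ _ _ X]xE hahn_int0_spike// subr0 => /eqP.
by rewrite mulf_eq0 (negbTE w1) mulf_eq0 (negbTE w2) => /eqP.
Qed.

(** The orbit of an end point equal to [w0] is reduced to [w0]; there the value
    is a limit of values along the orbit of the other end point. *)
Lemma euler_lagrange_interval t : hahn_interval q w a b t ->
  euler_lagrange t = 0.
Proof.
have [x xab xw] : exists2 x, x = a \/ x = b & x != w0.
  have [aw|aw] := eqVneq a w0; last by exists a; [left|].
  by exists b; [right|rewrite -aw gt_eqF].
have EL0 : euler_lagrange w0 = 0.
  have Ix : I x by case: xab => ->.
  have cE := cvg_orbit_within hq hI hI0 Ix continuous_euler_lagrange.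
  apply/esym; rewrite -(cvg_lim _ cE)//; apply/esym/cvg_lim => //.
  by apply: cvg_near_cst; near=> k => /=; exact: euler_lagrange_orbit.
have ELx z : z = a \/ z = b -> hahn_orbit q w z `<=` [set t | euler_lagrange t = 0].
  move=> zab; rewrite hahn_orbitP// => _ [k _ <-] /=.
  have [->|zw] := eqVneq z w0; last exact: euler_lagrange_orbit.
  by rewrite /orbit_pt subrr mulr0 addr0.
by case=> [[|]|->//]; apply: ELx; [left|right].
Unshelve. all: by end_near. Qed.

Lemma hahn_int_first_variation_boundary h : Y1 h ->
  hahn_int q w a b (delta h) =
  h a * (hahn_int q w a b ma - m1 a)
  + h b * (hahn_int q w a b mb + m1 b).
Proof.
move=> Yh; rewrite hahn_int_first_variation// -[RHS]add0r -addrA; congr (_ + _).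
have EL x : x = a \/ x = b ->
    hahn_int0 q w (fun t => euler_lagrange t * h (q * t + w)) x = 0.
  move=> xab; rewrite (@hahn_int0_single _ _ _ hq _ _ 0%N) => [|k _];
  rewrite euler_lagrange_interval ?mul0r ?mulr0//; exact: hahn_interval_orbit.
by rewrite /hahn_int !EL ?subrr//; [left|right].
Qed.

End EulerLagrange.

Theorem theorem3p5 (R : realType) (q w : R) (I : set R) (a b : R)
    (L : R -> 'rV[R]_4 -> R) (alpha beta : option R) (ytilde : R -> R)
    (hq : 0 < q < 1) (hw : 0 <= w)
    (hI : is_interval I) (hI0 : I (omega0 q w)) (hIa : I a) (hIb : I b)
    (hab : a < b)
    (horb : hahn_orbit q w a `&` hahn_orbit q w b = set0)
    (H1 : forall t, I t -> C1 (L t))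
    (H2 : forall y, in_Y q w I a b 1 y ->
       continuous_within_at I (along q w I a b L y) (omega0 q w))
    (H3 : forall y, in_Y q w I a b 1 y -> forall i, (2 <= i <= 5)%N ->
       in_Y q w I a b 1 (along q w I a b (partial_L i L) y))
    (Hi : forall y h, in_Y q w I a b 1 y -> in_Y q w I a b 1 h ->
       unif_derivable0 (hahn_interval q w a b) (variation_along q w I a b L y h))
    (Hii : forall y h, in_Y q w I a b 1 y -> in_Y q w I a b 1 h ->
       \forall e \near (0 : R),
         hahn_int0_exists q w (fun t => variation_along q w I a b L y h t e) a /\
         hahn_int0_exists q w (fun t => variation_along q w I a b L y h t e) b)
    (Hiii : forall y h, in_Y q w I a b 1 y -> in_Y q w I a b 1 h ->
       hahn_int0_exists q w (fun t => derive1 (variation_along q w I a b L y h t) 0) a /\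
       hahn_int0_exists q w (fun t => derive1 (variation_along q w I a b L y h t) 0) b)
    (Hext : local_minimizer q w I a b L alpha beta ytilde \/
            local_maximizer q w I a b L alpha beta ytilde) :
  [/\ forall t, hahn_interval q w a b t ->
        along q w I a b (partial_L 2 L) ytilde t
        - hahn q w I (along q w I a b (partial_L 3 L) ytilde) t = 0,
      alpha = None ->
        along q w I a b (partial_L 3 L) ytilde a =
        hahn_int q w a b (along q w I a b (partial_L 4 L) ytilde)
    & beta = None ->
        along q w I a b (partial_L 3 L) ytilde b =
        - hahn_int q w a b (along q w I a b (partial_L 5 L) ytilde)].
Proof.
have [Yy _ _] : admissible q w I a b alpha beta ytilde.
  exact: extremizer_admissible Hext.
have /in_Y1P[_ _ cP2 _ _] := H3 _ Yy 2%N isT.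
have /in_Y1P[_ _ cP3 _ cDP3] := H3 _ Yy 3%N isT.
have /in_Y1P[_ _ cP4 _ _] := H3 _ Yy 4%N isT.
have /in_Y1P[_ _ cP5 _ _] := H3 _ Yy 5%N isT.
have FV h := @first_variation_eq0 _ _ _ _ _ _ _ hq hI hI0 hIa hIb hab H1 Hi Hii
  Hiii _ _ _ Hext h.
have stat h : in_Y q w I a b 1 h -> h a = 0 -> h b = 0 ->
    hahn_int q w a b (first_variation q w I a b
      (along q w I a b (partial_L 2 L) ytilde)
      (along q w I a b (partial_L 3 L) ytilde)
      (along q w I a b (partial_L 4 L) ytilde)
      (along q w I a b (partial_L 5 L) ytilde) h) = 0.
  by move=> Yh ha hb; apply: FV.
have BV h Yh := @hahn_int_first_variation_boundary _ _ _ _ _ _ hq hI hI0 hIa hIb hab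
  _ _ _ _ cP2 cP3 cDP3 cP4 cP5 horb stat h Yh.
have ba : b - a != 0 by rewrite subr_eq0 gt_eqF.
have Yaff c d := in_Y1_affine hq hI hI0 hIa hIb hab c d.
split.
- exact: (euler_lagrange_interval hq hI hI0 hIa hIb hab cP2 cP3 cDP3 cP4 cP5 horb stat).
- move=> a0; have Yh := Yaff (b / (b - a)) (- (b - a)^-1).
  (* The affine function [t |-> (b - t) / (b - a)]. *)
  have ha : b / (b - a) + - (b - a)^-1 * a = 1 by field.
  have hb : b / (b - a) + - (b - a)^-1 * b = 0 by field.
  have := BV _ Yh; rewrite FV//.
  by rewrite /= ha hb mul1r mul0r addr0 => /esym/eqP; rewrite subr_eq0 => /eqP.
- move=> b0; have Yh := Yaff (- a / (b - a)) (b - a)^-1.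
  (* The affine function [t |-> (t - a) / (b - a)]. *)
  have ha : - a / (b - a) + (b - a)^-1 * a = 0 by field.
  have hb : - a / (b - a) + (b - a)^-1 * b = 1 by field.
  have := BV _ Yh; rewrite FV//.
  rewrite /= ha hb mul1r mul0r add0r => /esym/eqP; rewrite addrC addr_eq0.
  by move=> /eqP.
Qed.
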